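(* The problem Vertex Cover Below Tight Upper Bound-2 (VCU2), parameterized by $k$, is W[1]-hard.
   Context: A vertex cover of a graph is a set of vertices containing at least one endpoint of every edge. VCU2: given a graph $G$, a maximal matching $M$ of $G$ (a matching to which no further edge of $G$ can be added), and a positive integer $k$, decide whether $G$ has a vertex cover with at most $2|M|-k$ vertices; the parameter is $k$. W[1]-hardness is with respect to parameterized (fpt) reductions; Independent Set parameterized by solution size is W[1]-hard. *)

(* Defs.v *)
From mathcomp Require Import all_boot.
Set Implicit Arguments. Unset Strict Implicit. Unset Printing Implicit Defensive.

Definition simple_graph n (e : rel 'I_n) : Prop :=
  (forall i, ~~ e i i) /\ (forall i j, e i j = e j i).

Definition edges n (e : rel 'I_n) : {set {set 'I_n}} :=
  [set f : {set 'I_n} | [exists i : 'I_n, exists j : 'I_n, e i j && (f == [set i; j])]].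

Definition is_vertex_cover n (e : rel 'I_n) (C : {set 'I_n}) : Prop :=
  forall i j, e i j -> (i \in C) || (j \in C).

Definition is_independent n (e : rel 'I_n) (S : {set 'I_n}) : Prop :=
  forall i j, i \in S -> j \in S -> ~~ e i j.

Definition is_matching n (e : rel 'I_n) (M : {set {set 'I_n}}) : Prop :=
  M \subset edges e /\
  (forall f g, f \in M -> g \in M -> f != g -> [disjoint f & g]).

Definition is_maximal_matching n (e : rel 'I_n) (M : {set {set 'I_n}}) : Prop :=
  is_matching e M /\
  (forall f, f \in edges e -> f \notin M -> ~ is_matching e (f |: M)).

Definition enc_rel n (r : rel 'I_n) : seq bool :=
  [seq r i j | i <- enum 'I_n, j <- enum 'I_n].

Definition enc_graph n (e : rel 'I_n) : seq bool :=
  nseq n true ++ false :: enc_rel e.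

Definition enc_graph_matching n (e : rel 'I_n) (M : {set {set 'I_n}}) : seq bool :=
  enc_graph e ++ enc_rel (fun i j => [set i; j] \in M).

Definition param_problem := seq bool -> nat -> Prop.

Definition IndependentSet : param_problem := fun x k =>
  exists n (e : rel 'I_n), x = enc_graph e /\ simple_graph e /\
    exists S : {set 'I_n}, is_independent e S /\ #|S| = k.

Definition VCU2 : param_problem := fun x k =>
  exists n (e : rel 'I_n) (M : {set {set 'I_n}}),
    x = enc_graph_matching e M /\ simple_graph e /\ is_maximal_matching e M /\
    0 < k /\
    exists C : {set 'I_n}, is_vertex_cover e C /\ #|C| + k <= 2 * #|M|.

(* Machine model: deterministic single-tape Turing machines.           *)
(* Tape symbols 'I_(s+4): 0 = blank, 1 = bit 0, 2 = bit 1, 3 = '#';    *)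
(* the remaining symbols are work symbols.  States 'I_(q+1), start     *)
(* state 0; the machine halts when the transition is undefined.        *)

Record TM := mkTM {
  tm_nst : nat;
  tm_nsym : nat;
  tm_delta : 'I_tm_nst.+1 -> 'I_tm_nsym.+4 ->
             option ('I_tm_nst.+1 * 'I_tm_nsym.+4 * bool) (* true = move right *)
}.

Definition tm_sym (M : TM) := 'I_(tm_nsym M).+4.
Definition tm_state (M : TM) := 'I_(tm_nst M).+1.

(* configuration: state, tape left of head (nearest first), head symbol,
   tape right of head; unlisted cells are blank *)
Definition config (M : TM) :=
  (tm_state M * seq (tm_sym M) * tm_sym M * seq (tm_sym M))%type.

Definition tm_blank (M : TM) : tm_sym M := ord0.

Definition step (M : TM) (c : config M) : option (config M) :=
  let: (q, l, a, r) := c in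
  match @tm_delta M q a with
  | None => None
  | Some (q', b, true) => Some (q', b :: l, head (tm_blank M) r, behead r)
  | Some (q', b, false) => Some (q', behead l, head (tm_blank M) l, b :: r)
  end.

Definition halted (M : TM) (c : config M) : bool :=
  if step c is Some _ then false else true.

Fixpoint run (M : TM) (t : nat) (c : config M) : config M :=
  match t with
  | 0 => c
  | t'.+1 => match step c with None => c | Some c' => run t' c' end
  end.

Definition init (M : TM) (w : seq nat) : config M :=
  match [seq (inord a : tm_sym M) | a <- w] with
  | [::] => (ord0, [::], tm_blank M, [::])
  | a :: r => (ord0, [::], a, r)
  end.

Fixpoint take_nonblank (s : seq nat) : seq nat :=
  match s with
  | [::] => [::]
  | 0 :: _ => [::]
  | a :: r => a :: take_nonblank r
  end.

Definition tm_output (M : TM) (c : config M) : seq nat :=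
  let: (_, _, a, r) := c in take_nonblank [seq nat_of_ord b | b <- a :: r].

Definition computes_within (M : TM) (t : nat) (w v : seq nat) : Prop :=
  let c := run t (init M w) in halted c /\ tm_output c = v.

Definition enc_inst (x : seq bool) (k : nat) : seq nat :=
  [seq (if b then 2 else 1) | b <- x] ++ 3 :: nseq k 2.

Definition computable (g : nat -> nat) : Prop :=
  exists M : TM, forall n, exists t, computes_within M t (nseq n 2) (nseq (g n) 2).

(* fpt-reduction (Flum--Grohe): R maps (x,k) to (x',k') with
   (x,k) in A <-> (x',k') in B, k' <= g(k), computable in time
   f(k) * p(|x| + k) for computable f, g and a polynomial p. *)
Definition fpt_reduction (A B : param_problem) : Prop :=
  exists (R : seq bool -> nat -> seq bool * nat) (M : TM) (f g : nat -> nat) (c : nat),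
    computable f /\ computable g /\
    (forall x k, A x k <-> B (R x k).1 (R x k).2) /\
    (forall x k, (R x k).2 <= g k) /\
    (forall x k, computes_within M (f k * (size x + k).+2 ^ c)
                                   (enc_inst x k) (enc_inst (R x k).1 (R x k).2)).

(* W[1]-hardness, witnessed by an fpt-reduction from the W[1]-complete
   problem Independent Set (parameterized by solution size). *)
Definition W1_hard (B : param_problem) : Prop := fpt_reduction IndependentSet B.

(* Main.v *)
(** Replace every vertex of [K_1 + G] by a pair of adjacent twins.  The twin
    pairs form a perfect matching [M], and an independent set uses at most one
    vertex of each pair, so the new graph has a vertex cover of size at most
    [2 |M| - (k + 1)] iff [K_1 + G] has an independent set of size [k + 1], i.e.
    iff [G] has one of size [k].  The extra vertex makes the new parameter
    positive.  Loops and asymmetric entries of the input matrix are copied to the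
    output, so the machine only has to reject inputs of the wrong length.

    The Turing machine is obtained from a program for a machine with several
    queues: each queue is a track of the tape, and every queue operation is one
    sweep of the head, which costs a quadratic slow-down. *)
From HB Require Import structures.
Require Import Defs.
From mathcomp Require Import all_boot.
From mathcomp Require Import zify.
Set Implicit Arguments. Unset Strict Implicit. Unset Printing Implicit Defensive.

(** * Turing machines over finite types *)

(** A halted configuration repeats forever, so a run is a plain iteration and runs compose by
    [iterD]. *)
Definition tm_next (M : TM) (c : config M) : config M := odflt c (step c).

Lemma runE (M : TM) t (c : config M) : run t c = iter t (@tm_next M) c.
Proof.
elim: t c => //= t IH c; rewrite -iterS iterSr /tm_next; case E: (step c) => [c'|] //=.
by elim: {IH} t => //= t <-; rewrite E.
Qed.

Definition code (a : option bool) : nat :=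
  match a with Some false => 1 | Some true => 2 | None => 3 end.

Section FiniteTypeMachines.
Variables (Q S : finType) (q0 : Q) (blank : S) (inp : option bool -> S).
Variable D : Q -> S -> option (Q * S * bool).
Hypothesis inp_inj : injective inp.
Hypothesis inp_blank : forall a, inp a != blank.

Definition fconfig := (Q * seq S * S * seq S)%type.

Definition fstep (c : fconfig) : option fconfig :=
  let: (q, l, a, r) := c in
  match D q a with
  | None => None
  | Some (q', b, true) => Some (q', b :: l, head blank r, behead r)
  | Some (q', b, false) => Some (q', behead l, head blank l, b :: r)
  end.

Definition fnext (c : fconfig) : fconfig := odflt c (fstep c).

(** The model fixes 0 for the blank and 1, 2, 3 for the input letters; every other symbol is moved
    beyond these by its rank. *)
Definition sym_code (c : S) : nat :=
  if c == blank then 0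
  else if [pick a | inp a == c] is Some a then code a else 4 + enum_rank c.

Lemma sym_code_blank : sym_code blank = 0.
Proof. by rewrite /sym_code eqxx. Qed.

Lemma sym_code_inp a : sym_code (inp a) = code a.
Proof.
rewrite /sym_code (negbTE (inp_blank a)).
case: pickP => [b /eqP /inp_inj -> //|/(_ a)]; by rewrite eqxx.
Qed.

Lemma sym_code_lt c : sym_code c < #|S|.+4.
Proof.
rewrite /sym_code; case: eqP => // _; case: pickP => [[[]|] _ //|_].
by rewrite -[#|S|.+4]add4n ltn_add2l.
Qed.

Lemma code_inj : injective code.
Proof. by move=> [[]|] [[]|]. Qed.

Lemma sym_code_inj : injective sym_code.
Proof.
move=> c d; rewrite /sym_code.
case: (c =P blank) => [->|_]; case: (d =P blank) => [->|_] //.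
- by case: pickP => [[[]|] //|].
- by case: pickP => [[[]|] //|].
case: pickP => [a /eqP <-|_]; case: pickP => [b /eqP <-|_].
- by move/code_inj->.
- by case: a => [[]|].
- by case: b => [[]|].
- by move/addnI/val_inj/enum_rank_inj.
Qed.

Definition encS c : 'I_#|S|.+4 := Ordinal (sym_code_lt c).

Lemma encS_inj : injective encS.
Proof. by move=> c d /(congr1 val) /= /sym_code_inj. Qed.

(** State 0 must be the start state, so the ranks are shifted up by one to make room for it. *)
Definition encQ (q : Q) : 'I_#|Q|.+1 :=
  if q == q0 then ord0 else lift ord0 (enum_rank q).

Lemma encQ_inj : injective encQ.
Proof.
move=> p q; rewrite /encQ; case: (p =P q0) => [->|_]; case: (q =P q0) => [->|_] //.
by move/lift_inj/enum_rank_inj.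
Qed.

Definition fin_delta (q : 'I_#|Q|.+1) (a : 'I_#|S|.+4) :
    option ('I_#|Q|.+1 * 'I_#|S|.+4 * bool) :=
  if [pick p | encQ p == q] is Some p then
    if [pick c | encS c == a] is Some c then
      if D p c is Some (p', b, d) then Some (encQ p', encS b, d) else None
    else None
  else None.

Definition fin_TM : TM := mkTM fin_delta.

Definition enc_config (c : fconfig) : config fin_TM :=
  let: (q, l, a, r) := c in (encQ q, map encS l, encS a, map encS r).

Lemma pick_inj (T : finType) (T' : eqType) (f : T -> T') x :
  injective f -> [pick y | f y == f x] = Some x.
Proof.
move=> f_inj; case: pickP => [y /eqP /f_inj -> //|/(_ x)]; by rewrite eqxx.
Qed.

Lemma encS_blank : encS blank = tm_blank fin_TM.
Proof. by apply: val_inj; rewrite /= sym_code_blank. Qed.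

Lemma step_enc c : step (enc_config c) = omap enc_config (fstep c).
Proof.
case: c => [[[q l] a] r] /=.
rewrite /fin_delta (pick_inj _ encQ_inj) (pick_inj _ encS_inj).
case: (D q a) => [[[q' b] []]|] //=; rewrite -encS_blank.
- by case: r.
- by case: l.
Qed.

Lemma iter_enc t c : iter t (@tm_next fin_TM) (enc_config c) = enc_config (iter t fnext c).
Proof.
elim: t => //= t ->; rewrite /tm_next /fnext step_enc.
by case: (fstep _).
Qed.

(* The head is on the first cell of [r], or on a blank cell when [r] is empty. *)
Definition atr q l r : fconfig := (q, l, head blank r, behead r).

(* The head is on the first cell of [l], which lists the tape leftwards. *)
Definition atl q l r : fconfig := (q, behead l, head blank l, r).

Lemma sweep_right q g cs l r :
  {in cs, forall c, D q c = Some (q, g c, true)} ->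
  iter (size cs) fnext (atr q l (cs ++ r)) = atr q (catrev (map g cs) l) r.
Proof.
elim: cs l => //= c cs IH l Dc; rewrite -iterS iterSr /fnext /= Dc ?mem_head //=.
by apply: IH => d d_cs; apply: Dc; rewrite inE d_cs orbT.
Qed.

Lemma sweep_left q cs l r :
  {in cs, forall c, D q c = Some (q, c, false)} ->
  iter (size cs) fnext (atl q (cs ++ l) r) = atl q l (catrev cs r).
Proof.
elim: cs r => //= c cs IH r Dc; rewrite -iterS iterSr /fnext /= Dc ?mem_head //=.
by apply: IH => d d_cs; apply: Dc; rewrite inE d_cs orbT.
Qed.

(** Once in [q] the machine stays there, so any bound [t'] above the exact time [t] will do; the
    blank after [v] delimits the output. *)
Lemma fin_TM_computes t t' q l w v r :
  0 < size w -> t <= t' ->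
  iter t fnext (atr q0 [::] (map inp w)) = atr q l (map inp v ++ blank :: r) ->
  (forall c, D q c = None) ->
  computes_within fin_TM t' (map code w) (map code v).
Proof.
move=> w_gt0 le_tt' run_w Dq; rewrite /computes_within runE.
have -> : init fin_TM (map code w) = enc_config (atr q0 [::] (map inp w)).
  rewrite /init; have -> : [seq (inord a : tm_sym fin_TM) | a <- map code w] = map encS (map inp w).
    rewrite -!map_comp; apply: eq_map => a /=; apply: val_inj => /=.
    by rewrite sym_code_inp inordK //; case: a => [[]|].
  by case: w w_gt0 {run_w} => //= a w _; rewrite /encQ eqxx.
rewrite iter_enc -(subnK le_tt') iterD run_w.
have halt_q u m : iter m fnext (atr q l u) = atr q l u.
  by elim: m => //= m ->; rewrite /fnext /= Dq.
rewrite halt_q; split; first by rewrite /halted step_enc /= Dq.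
have -> u : tm_output (enc_config (atr q l (u ++ blank :: r))) =
    take_nonblank (map sym_code (u ++ blank :: r)).
  rewrite /=; case: u => [|c u] /=; rewrite -!map_comp //.
rewrite map_cat /= sym_code_blank -map_comp.
elim: v {run_w} => //= a v IH; rewrite sym_code_inp IH.
by case: a => [[]|].
Qed.

End FiniteTypeMachines.

(** * Queue machines *)

Section QueueMachines.
Variables K Lb : finType.
Notation A := (option bool).

Inductive instr :=
  | Push of K & A & Lb
  | Pop of K & (option A -> Lb)
  | Halt of K.

Variables (prog : Lb -> instr) (l0 : Lb) (k0 : K).

Definition store := {ffun K -> seq A}.

Definition upd (T : Type) (f : {ffun K -> T}) t x : {ffun K -> T} :=
  [ffun u => if u == t then x else f u].

Definition qnext (c : Lb * store) : Lb * store :=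
  let: (l, s) := c in
  match prog l with
  | Push t a l' => (l', upd s t (rcons (s t) a))
  | Pop t k => (k (ohead (s t)), upd s t (behead (s t)))
  | Halt t => c
  end.

(* Each queue lives on its own track of the tape.  On a track, [None] is a
   cell never written, [Some None] a popped cell and [Some (Some a)] a cell
   holding [a]; popped cells precede the queue, free cells follow it. *)
Definition cell := {ffun K -> option (option A)}.
Definition qblank : cell := [ffun => None].
Definition qinp (a : A) : cell := [ffun u => if u == k0 then Some (Some a) else None].

(** [Scan] moves right to the cell on which the instruction acts, [Back] returns to the blank cell
    left of all tracks; [Out] is the last return and [Done] the halting state. *)
Definition qstate := ((bool * Lb) + bool)%type.
Definition Scan l : qstate := inl (true, l).
Definition Back l : qstate := inl (false, l).
Definition Out : qstate := inr true.
Definition Done : qstate := inr false.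

(** On [Halt] the sweep wipes all tracks and rewrites the output queue on the input track. Popped
    cells become blank, so the returning head stops right before the output. *)
Definition qdelta (q : qstate) (c : cell) : option (qstate * cell * bool) :=
  match q with
  | inl (true, l) =>
    match prog l with
    | Push t a l' =>
      if c t is None then Some (Back l', upd c t (Some (Some a)), false)
      else Some (q, c, true)
    | Pop t k =>
      match c t with
      | None => Some (Back (k None), c, false)
      | Some None => Some (q, c, true)
      | Some (Some a) => Some (Back (k (Some a)), upd c t (Some None), false)
      end
    | Halt t =>
      match c t with
      | None => Some (Out, qblank, false)
      | Some None => Some (q, qblank, true)
      | Some (Some a) => Some (q, qinp a, true)
      end
    end
  | inl (false, l) =>
    if c == qblank then Some (Scan l, qblank, true) else Some (q, c, false)
  | inr true =>
    if c == qblank then Some (Done, qblank, true) else Some (q, c, false)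
  | inr false => None
  end.

Lemma qinp_inj : injective qinp.
Proof. by move=> a b /ffunP /(_ k0); rewrite !ffunE eqxx => -[]. Qed.

Lemma qinp_blank a : qinp a != qblank.
Proof. by apply/eqP => /ffunP /(_ k0); rewrite !ffunE eqxx. Qed.

Notation qfnext := (fnext qblank qdelta).
Notation qatr := (atr qblank).
Notation qatl := (atl qblank).

(** * Tape contents that represent a store *)

Definition track (e : nat) (s : seq A) (p : nat) : option (option A) :=
  if p < e then Some None else omap Some (onth s (p - e)).

Definition cell_at (e : {ffun K -> nat}) (s : store) (p : nat) : cell :=
  [ffun t => track (e t) (s t) p].

Definition tape e s L := [seq cell_at e s p | p <- iota 0 L].

Definition fits (e : {ffun K -> nat}) (s : store) L := forall t, e t + size (s t) <= L.

Lemma onth_some (x0 : A) s n : n < size s -> onth s n = Some (nth x0 s n).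
Proof. by elim: n s => [|n IH] [|x s] //= /IH. Qed.

Lemma track_None e s p : e + size s <= p -> track e s p = None.
Proof. move=> le_p; rewrite /track ltnNge (leq_trans _ le_p) ?leq_addr //= onth_default //; lia. Qed.

Lemma track_Some e s p : p < e + size s -> track e s p != None.
Proof.
rewrite /track; case: (ltnP p e) => // le_ep lt_p.
by rewrite (onth_some None) //; lia.
Qed.

Lemma cell_at_blank e s L p : fits e s L -> L <= p -> cell_at e s p = qblank.
Proof.
move=> fit le_Lp; apply/ffunP => t; rewrite !ffunE track_None //.
exact: leq_trans (fit t) le_Lp.
Qed.

(** At [p = L] the head leaves the listed cells and reads a blank, which is also the value of
    [cell_at] there. *)
Lemma tape_at (q : qstate) l e s L p : fits e s L -> p <= L ->
  qatr q l [seq cell_at e s i | i <- iota p (L - p)] =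
  qatr q l (cell_at e s p :: [seq cell_at e s i | i <- iota p.+1 (L - p.+1)]).
Proof.
rewrite leq_eqVlt => fit /orP[/eqP ->|lt_p].
  by rewrite subnn subnS subnn /= /atr /= (cell_at_blank fit).
by rewrite subnS; case: (L - p) (subn_gt0 p L) => [|m]; rewrite ?lt_p.
Qed.

Lemma tape_split e s L p : p <= L ->
  tape e s L = [seq cell_at e s i | i <- iota 0 p] ++ [seq cell_at e s i | i <- iota p (L - p)].
Proof. by move=> le_p; rewrite /tape -map_cat -{2}(add0n p) -iotaD subnKC. Qed.

(** Common shape of pushes and pops, acting on cell [p]: [p] steps each way, one to leave the left
    marker and one to turn. The cells before [p] are nonblank, so the return ends only at the
    marker. *)
Lemma qstep_sim l l' e s e' s' L p :
  fits e s L -> p <= L ->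
  (forall i, i < p -> qdelta (Scan l) (cell_at e s i) = Some (Scan l, cell_at e s i, true)) ->
  (forall i, i < p -> cell_at e s i != qblank) ->
  qdelta (Scan l) (cell_at e s p) = Some (Back l', cell_at e' s' p, false) ->
  (forall i, i != p -> cell_at e' s' i = cell_at e s i) ->
  iter (p + 2 + p) qfnext (qatl (Back l) [:: qblank] (tape e s L)) =
  qatl (Back l') [:: qblank] (tape e' s' (maxn L p.+1)).
Proof.
move=> fit le_p scan nblank turn same.
rewrite (tape_split e s le_p) addnC iterD addn2 iterSr.
have -> : qfnext (qatl (Back l) [:: qblank] ([seq cell_at e s i | i <- iota 0 p] ++ [seq cell_at e s i | i <- iota p (L - p)])) =
  qatr (Scan l) [:: qblank] ([seq cell_at e s i | i <- iota 0 p] ++ [seq cell_at e s i | i <- iota p (L - p)]).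
  by rewrite /fnext /= eqxx.
have szp : size [seq cell_at e s i | i <- iota 0 p] = p by rewrite size_map size_iota.
rewrite iterS -{2}szp (@sweep_right _ _ _ _ _ id); last first.
  by move=> c /mapP[i]; rewrite mem_iota => /andP[_ lt_i] ->; apply: scan.
rewrite map_id tape_at // catrevE.
set post := [seq _ | i <- iota p.+1 _]; set pre := [seq _ | i <- iota 0 p].
have -> x : qfnext (qatr (Scan l) x (cell_at e s p :: post)) =
            qatl (Back l') x (cell_at e' s' p :: post).
  by rewrite /fnext /=; move: turn => /= ->.
rewrite -{1}szp -size_rev sweep_left; last first.
  move=> c; rewrite mem_rev => /mapP[i]; rewrite mem_iota => /andP[_ lt_i] ->.
  by rewrite /= (negbTE (nblank _ lt_i)).
congr qatl; rewrite catrevE revK (@tape_split _ _ _ p) ?leq_max ?leqnSn ?orbT //.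
have -> : maxn L p.+1 - p = (L - p.+1).+1 by lia.
rewrite /=; congr (_ ++ _ :: _); apply/eq_in_map => i; rewrite mem_iota => h; rewrite same //; lia.
Qed.

Lemma cell_atE e s p t : cell_at e s p t = track (e t) (s t) p.
Proof. by rewrite ffunE. Qed.

Lemma cell_at_nblank (e : {ffun K -> nat}) (s : store) p t : p < e t + size (s t) -> cell_at e s p != qblank.
Proof.
move=> lt_p; apply/eqP => /ffunP /(_ t); rewrite !ffunE => h.
by move: (track_Some lt_p); rewrite h.
Qed.

Lemma qnext_sim l s e L : fits e s L -> (forall t, prog l <> Halt t) ->
  exists n e' L', [/\ n <= L.*2.+2, L' <= L.+1, fits e' (qnext (l, s)).2 L' &
    iter n qfnext (qatl (Back l) [:: qblank] (tape e s L)) =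
    qatl (Back (qnext (l, s)).1) [:: qblank] (tape e' (qnext (l, s)).2 L')].
Proof.
move=> fit; rewrite /qnext; case prog_l: (prog l) => [t a l'|t k|t] no_halt; last by case: (no_halt t).
(* A push acts on the first free cell of its track. *)
- have le_p := fit t; set p := e t + size (s t) in le_p.
  exists (p + 2 + p), e, (maxn L p.+1); split=> /=; try lia.
    by move=> u; rewrite ffunE; case: eqP => [->|_]; rewrite ?size_rcons; [|have := fit u]; lia.
  apply: qstep_sim => // [i lt_i|i lt_i||i ne_i].
  + rewrite /= prog_l cell_atE.
    by have := track_Some lt_i; case: track.
  + exact: cell_at_nblank lt_i.
  + rewrite /= prog_l cell_atE track_None //; congr (Some (_, _, _)).
    apply/ffunP => u; rewrite !ffunE; case: eqP => // ->.
    rewrite /track ltnNge leq_addr /= addKn (onth_some None) ?size_rcons //.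
    by rewrite nth_rcons ltnn eqxx.
  + apply/ffunP => u; rewrite !ffunE; case: eqP => // ->; rewrite /track.
    case: ltnP => // le_i; congr omap.
    case: (ltnP (i - e t) (size (s t))) => h.
      by rewrite !(onth_some None) ?size_rcons ?nth_rcons ?h //; lia.
    by rewrite !onth_default ?size_rcons //; lia.
case st: (s t) => [|a w] /=.
(* Popping an empty queue: the scan passes the popped cells, meets a free one and turns without
   changing it. *)
- have fit' : fits e (upd s t [::]) L by move=> u; rewrite ffunE; case: eqP => [->|_] //=; have := fit t; lia.
  have le_p : e t <= L by have := fit t; lia.
  have same i : cell_at e (upd s t [::]) i = cell_at e s i.
    by apply/ffunP => u; rewrite !ffunE; case: eqP => // ->; rewrite st.
  exists (e t + 2 + e t), e, (maxn L (e t).+1); split; try lia.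
    by move=> u; have := fit' u; lia.
  apply: qstep_sim => // [i lt_i|i lt_i|].
  + by rewrite /= prog_l cell_atE /track lt_i.
  + by apply: (@cell_at_nblank _ _ _ t); lia.
  + by rewrite /= prog_l cell_atE st track_None ?addn0 // same.
(* A nonempty queue loses its front cell to the popped prefix of the track. *)
have le_p : (e t).+1 <= L by have := fit t; rewrite st /=; lia.
exists (e t + 2 + e t), (upd e t (e t).+1), (maxn L (e t).+1); split; try lia.
  move=> u; rewrite !ffunE; have := fit u; case: eqP => [->|_]; rewrite ?st /=; lia.
apply: qstep_sim => // [|i lt_i|i lt_i||i ne_i].
- by lia.
- by rewrite /= prog_l cell_atE /track lt_i.
- by apply: (@cell_at_nblank _ _ _ t); lia.
- rewrite /= prog_l cell_atE st /track ltnn subnn /=; congr (Some (_, _, _)).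
  by apply/ffunP => u; rewrite !ffunE; case: (u =P t) => [_|] //; rewrite /track leqnn.
apply/ffunP => u; rewrite !ffunE; case: (u =P t) => [->|] //; rewrite /track st.
case: (ltngtP i (e t)) => [h|h|h].
- by rewrite ltnS ltnW.
- by rewrite ltnS leqNgt h /=; case: (i - e t) (subnS i (e t)) (subn_gt0 (e t) i) => [|m] ->; rewrite ?h.
- by rewrite h eqxx in ne_i.
Qed.

Lemma qhalt_sim l t s e L : fits e s L -> prog l = Halt t ->
  exists n l' r, n <= L.*2 + 4 /\
    iter n qfnext (qatl (Back l) [:: qblank] (tape e s L)) =
    qatr Done l' (map qinp (s t) ++ qblank :: r).
Proof.
move=> fit prog_l; have le_p := fit t; set p := e t + size (s t) in le_p.
set post := [seq cell_at e s i | i <- iota p.+1 (L - p.+1)].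
(* The effect of the final sweep on a single cell. *)
pose g (c : cell) := if c t is Some (Some a) then qinp a else qblank.
have szp : size [seq cell_at e s i | i <- iota 0 p] = p by rewrite size_map size_iota.
have gpre : map g [seq cell_at e s i | i <- iota 0 p] = nseq (e t) qblank ++ map qinp (s t).
  rewrite -map_comp iotaD map_cat; congr (_ ++ _).
    apply: (@eq_from_nth _ qblank); rewrite ?size_map ?size_iota ?size_nseq // => i lt_i.
    by rewrite (nth_map 0) ?size_iota // nth_iota // nth_nseq lt_i /= /g cell_atE /track lt_i.
  apply: (@eq_from_nth _ qblank); rewrite ?size_map ?size_iota // => i lt_i.
  rewrite (nth_map 0) ?size_iota // nth_iota // (nth_map None) // /= /g cell_atE /track add0n.
  by rewrite ltnNge leq_addr /= addKn (onth_some None).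
exists (size (s t) + (1 + (p + 1))).+1.
exists (qblank :: behead (nseq (e t) qblank ++ [:: qblank])), post; split; first lia.
rewrite iterS iterD iterD iterD (tape_split e s le_p).
have -> : iter 1 qfnext (qatl (Back l) [:: qblank] ([seq cell_at e s i | i <- iota 0 p] ++ [seq cell_at e s i | i <- iota p (L - p)])) =
  qatr (Scan l) [:: qblank] ([seq cell_at e s i | i <- iota 0 p] ++ [seq cell_at e s i | i <- iota p (L - p)]).
  by rewrite /= /fnext /= eqxx.
rewrite -{1}szp (@sweep_right _ _ _ _ _ g); last first.
  move=> c /mapP[i]; rewrite mem_iota => /andP[_ lt_i] ->; rewrite /= prog_l /g cell_atE.
  by have := track_Some lt_i; case: track => [[]|].
rewrite tape_at // gpre catrevE rev_cat -catA -/post rev_nseq.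
have -> x : iter 1 qfnext (qatr (Scan l) x (cell_at e s p :: post)) =
            qatl Out x (qblank :: post).
  by rewrite /= /fnext /= prog_l cell_atE track_None.
rewrite -{1}(size_map qinp) -size_rev sweep_left; last first.
  by move=> c; rewrite mem_rev => /mapP[a _ ->]; rewrite /= (negbTE (qinp_blank a)).
(* The head stops on the wiped popped cell next to the output, or on the left marker if the track
   has no popped cell. *)
by rewrite catrevE revK; case: (e t) => [|m]; rewrite /= /fnext /= eqxx.
Qed.

(* A queue holds at most as many items as the input has symbols plus the
   number of executed pushes, which bounds every sweep of the head. *)
Theorem queue_machine_TM : exists M : TM, forall n w l t s,
  0 < size w ->
  iter n qnext (l0, [ffun u => if u == k0 then w else [::]]) = (l, s) ->
  prog l = Halt t ->
  forall b, n.+1 * ((size w + n).*2 + 5) <= b ->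
  computes_within M b (map code w) (map code (s t)).
Proof.
exists (fin_TM (Back l0) qblank qinp qdelta) => n w l t s w_gt0 run_w prog_l b le_b.
pose s0 : store := [ffun u => if u == k0 then w else [::]].
pose e0 : {ffun K -> nat} := [ffun => 0].
have fit0 : fits e0 s0 (size w) by move=> u; rewrite !ffunE; case: eqP.
have tape0 : tape e0 s0 (size w) = map qinp w.
  apply: (@eq_from_nth _ qblank); rewrite ?size_map ?size_iota // => i lt_i.
  rewrite (nth_map 0) ?size_iota // nth_iota // (nth_map None) //.
  apply/ffunP => u; rewrite !ffunE /track subn0; case: eqP => _ //.
    by rewrite (onth_some None).
  by rewrite onth_default.
have sim m : m <= n -> exists d e L, [/\ d <= m * ((size w + n).*2 + 5), L <= size w + m,
    fits e (iter m qnext (l0, s0)).2 L &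
    iter d qfnext (qatl (Back l0) [:: qblank] (tape e0 s0 (size w))) =
    qatl (Back (iter m qnext (l0, s0)).1) [:: qblank] (tape e (iter m qnext (l0, s0)).2 L)].
  elim: m => [|m IH] le_m; first by exists 0, e0, (size w); split=> //; lia.
  have [d [e [L [le_d le_L fit sim]]]] := IH (ltnW le_m).
  rewrite iterS; case: (iter m _ _) fit sim => l1 s1 fit sim.
  case prog_l1: (prog l1) => [u a k|u k|u]; last first.
    by exists d, e, L; rewrite /qnext prog_l1; split=> //; lia.
  - have [|d' [e' [L' [le_d' le_L' fit' sim']]]] := qnext_sim (l := l1) fit; first by rewrite prog_l1.
    exists (d' + d), e', L'; split=> //; try lia.
    by rewrite iterD sim sim'.
  - have [|d' [e' [L' [le_d' le_L' fit' sim']]]] := qnext_sim (l := l1) fit; first by rewrite prog_l1.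
    exists (d' + d), e', L'; split=> //; try lia.
    by rewrite iterD sim sim'.
have [d [e [L [le_d le_L fit simd]]]] := sim n (leqnn n).
rewrite run_w in fit simd.
have [d' [l' [r [le_d' simd']]]] := qhalt_sim fit prog_l.
(* The head starts on the first input cell, one place right of where the invariant puts it. As this
   cell is not blank, one [Back] step corrects the position; it accounts for the final [+ 1]. *)
apply: (@fin_TM_computes _ _ _ _ _ _ qinp_inj qinp_blank ((d' + d) + 1) _ Done l' _ _ r) => //.
  by rewrite mulSn in le_b; lia.
rewrite iterD iterD -simd' -simd tape0; congr (iter _ _ (iter _ _ _)).
by case: w w_gt0 {run_w le_b s0 e0 fit0 tape0 sim le_d le_L simd} => //= a w _; rewrite /fnext /= (negbTE (qinp_blank a)).
Qed.



End QueueMachines.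

(** * The queue program *)

Inductive trk := TI | TO | TD | TT | TR.

Definition trk_ord (t : trk) : 'I_5 :=
  match t with
  | TI => @Ordinal 5 0 isT | TO => @Ordinal 5 1 isT | TD => @Ordinal 5 2 isT
  | TT => @Ordinal 5 3 isT | TR => @Ordinal 5 4 isT
  end.
Definition ord_trk (i : 'I_5) : trk :=
  match val i with 0 => TI | 1 => TO | 2 => TD | 3 => TT | _ => TR end.
Lemma trk_ordK : cancel trk_ord ord_trk. Proof. by case. Qed.
HB.instance Definition _ := Finite.copy trk (can_type trk_ordK).

(* [ph] is true while the adjacency matrix is produced and false for the
   matching, [fr]/[fc] flag the first row and column, [prev] is the next bit of
   the current unit vector, [lst] the last bit of it that was emitted. *)
Inductive lab :=
  | PD | PO1 | PO2 | LR | PE | PZ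
  | Cell (ph fr fc prev lst : bool)
  | Rd (ph fr prev old : bool)
  | E1 (ph fr prev old a : bool) | E2 (ph fr prev old a : bool)
  | E3 (ph fr prev old a : bool) | E4 (ph fr prev old a : bool)
  | E5 (ph fr prev old : bool)
  | ER (ph lst : bool) | Fl (ph lst : bool) | Fl2 (ph lst b : bool)
  | Fin | F1 | F2 | F3 | HO | Rej | HR.

Definition lab_code (l : lab) : 'I_23 * (bool * bool * bool * bool * bool) :=
  let o := (false, false, false, false, false) in
  match l with
  | PD => (@Ordinal 23 0 isT, o) | PO1 => (@Ordinal 23 1 isT, o)
  | PO2 => (@Ordinal 23 2 isT, o) | LR => (@Ordinal 23 3 isT, o)
  | PE => (@Ordinal 23 4 isT, o) | PZ => (@Ordinal 23 5 isT, o)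
  | Cell a b c d e => (@Ordinal 23 6 isT, (a, b, c, d, e))
  | Rd a b c d => (@Ordinal 23 7 isT, (a, b, c, d, false))
  | E1 a b c d e => (@Ordinal 23 8 isT, (a, b, c, d, e))
  | E2 a b c d e => (@Ordinal 23 9 isT, (a, b, c, d, e))
  | E3 a b c d e => (@Ordinal 23 10 isT, (a, b, c, d, e))
  | E4 a b c d e => (@Ordinal 23 11 isT, (a, b, c, d, e))
  | E5 a b c d => (@Ordinal 23 12 isT, (a, b, c, d, false))
  | ER a b => (@Ordinal 23 13 isT, (a, b, false, false, false))
  | Fl a b => (@Ordinal 23 14 isT, (a, b, false, false, false))
  | Fl2 a b c => (@Ordinal 23 15 isT, (a, b, c, false, false))
  | Fin => (@Ordinal 23 16 isT, o) | F1 => (@Ordinal 23 17 isT, o)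
  | F2 => (@Ordinal 23 18 isT, o) | F3 => (@Ordinal 23 19 isT, o)
  | HO => (@Ordinal 23 20 isT, o) | Rej => (@Ordinal 23 21 isT, o)
  | HR => (@Ordinal 23 22 isT, o)
  end.
Definition code_lab (x : 'I_23 * (bool * bool * bool * bool * bool)) : lab :=
  let: (i, (a, b, c, d, e)) := x in
  match val i with
  | 0 => PD | 1 => PO1 | 2 => PO2 | 3 => LR | 4 => PE | 5 => PZ
  | 6 => Cell a b c d e | 7 => Rd a b c d
  | 8 => E1 a b c d e | 9 => E2 a b c d e | 10 => E3 a b c d e | 11 => E4 a b c d e
  | 12 => E5 a b c d | 13 => ER a b | 14 => Fl a b | 15 => Fl2 a b c
  | 16 => Fin | 17 => F1 | 18 => F2 | 19 => F3 | 20 => HO | 21 => Rej | _ => HR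
  end.
Lemma lab_codeK : cancel lab_code code_lab. Proof. by case. Qed.
HB.instance Definition _ := Finite.copy lab (can_type lab_codeK).

(* [TI] holds the input, [TO] the output.  [TD] holds a row of the identity
   matrix closed by ['#'], which is shifted by one place while it is rotated
   once per row; [TT] collects the second row of each twin pair.  A missing
   input bit is read as [false]: reading past ['#'] removes it from [TI], so that
   the test in [Fin] fails exactly when the input has the wrong length. *)
Definition prog (l : lab) : instr trk lab :=
  match l with
  | PD => Push TD (Some false) PO1
  | PO1 => Push TO (Some true) PO2
  | PO2 => Push TO (Some true) LR
  | LR => Pop TI (fun a => if a == Some (Some true) then PD else PE)
  | PE => Push TD None PZ
  | PZ => Push TO (Some false) (Cell true true true true false)
  | Cell ph fr fc prev lst => Pop TD (fun a =>
      if a is Some (Some old) then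
        if [&& ph, ~~ fr & ~~ fc] then Rd ph fr prev old else E1 ph fr prev old false
      else ER ph lst)
  | Rd ph fr prev old => Pop TI (fun a => E1 ph fr prev old (a == Some (Some true)))
  | E1 ph fr prev old a => Push TO (Some a) (E2 ph fr prev old a)
  | E2 ph fr prev old a => Push TO (Some (a || prev)) (E3 ph fr prev old a)
  | E3 ph fr prev old a => Push TT (Some (a || prev)) (E4 ph fr prev old a)
  | E4 ph fr prev old a => Push TT (Some a) (E5 ph fr prev old)
  | E5 ph fr prev old => Push TD (Some prev) (Cell ph fr false old prev)
  | ER ph lst => Push TD None (Fl ph lst)
  | Fl ph lst => Pop TT (fun a =>
      if a is Some (Some b) then Fl2 ph lst b
      else if lst then if ph then Cell false true true true false else Fin
      else Cell ph false true false false)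
  | Fl2 ph lst b => Push TO (Some b) (Fl ph lst)
  | Fin => Pop TI (fun a => if a == Some None then F1 else Rej)
  | F1 => Push TO None F2
  | F2 => Push TO (Some true) F3
  | F3 => Pop TI (fun a => if a is Some _ then F2 else HO)
  | HO => Halt lab TO
  | Rej => Push TR None HR
  | HR => Halt lab TR
  end.

(** * Runs of the queue program *)

Notation bits := (map (@Some bool)).

Definition st (i o d t r : seq (option bool)) : store trk :=
  [ffun u => match u with TI => i | TO => o | TD => d | TT => t | TR => r end].

Lemma upd_st i o d t r u x : upd (st i o d t r) u x =
  match u with
  | TI => st x o d t r | TO => st i x d t r | TD => st i o x t r
  | TT => st i o d x r | TR => st i o d t x
  end.
Proof. by apply/ffunP; case: u; case; rewrite !ffunE. Qed.

Notation pnext := (qnext prog).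

Definition reach B (c c' : lab * store trk) := exists2 n, n <= B & iter n pnext c = c'.

Lemma reach_step B c c' : reach B (pnext c) c' -> reach B.+1 c c'.
Proof. by case=> n le_n run_n; exists n.+1; rewrite // iterSr. Qed.

Lemma reach_refl B c : reach B c c.
Proof. by exists 0. Qed.

Lemma reach_trans B1 B2 c1 c2 c3 : reach B1 c1 c2 -> reach B2 c2 c3 -> reach (B1 + B2) c1 c3.
Proof.
case=> n1 le1 run1 [n2 le2 run2]; exists (n2 + n1); first lia.
by rewrite iterD run1.
Qed.

Lemma reach_le B1 B2 c c' : B1 <= B2 -> reach B1 c c' -> reach B2 c c'.
Proof. by move=> le_B [n le_n run_n]; exists n => //; lia. Qed.

Ltac qstep := apply: reach_step; rewrite /qnext /= ?ffunE /= upd_st /=.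

(** The loop pushes before it tests, hence runs once more than there are leading [true]s: the
    additional round stands for the added vertex. The symbol [a] that ends the loop is consumed. *)
Lemma reach_header m a s o d :
  a != Some true ->
  reach (4 * m + 6) (PD, st (bits (nseq m true) ++ a :: s) o d [::] [::])
    (Cell true true true true false,
     st s (o ++ bits (rcons (nseq (m.+1).*2 true) false)) (d ++ bits (nseq m.+1 false) ++ [:: None]) [::] [::]).
Proof.
move=> a_nt; elim: m o d => [|m IH] o d.
  do 4 qstep; rewrite (negbTE (_ : Some a != Some (Some true))) //; do 2 qstep.
  by rewrite -!cats1 -!catA; apply: reach_refl.
rewrite (_ : 4 * m.+1 + 6 = (4 * m + 6).+4); last lia.
do 4 qstep; have := IH (rcons (rcons o (Some true)) (Some true)) (rcons d (Some false)).
by rewrite -!cats1 -!catA.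
Qed.

(** The two rows of the 2 by 2 block that replaces a matrix entry: [ad.1] is the adjacency of the
    base vertices, [ad.2] tells whether they coincide. *)
Definition twin_bits (ad : bool * bool) := [:: ad.1; ad.1 || ad.2].
Definition twin_bits' (ad : bool * bool) := [:: ad.1 || ad.2; ad.1].

(** A missing symbol or a '#' counts as [false]; [g] tells whether the row takes its bits from the
    input at all. *)
Fixpoint reads (g : bool) m (s : seq (option bool)) : seq bool :=
  if m is m'.+1 then (g && (ohead s == Some (Some true))) :: reads g m' (behead s) else [::].

Lemma readsE g m s : reads g m s = [seq g && (nth None s j == Some true) | j <- iota 0 m].
Proof.
elim: m s => //= m IH s; rewrite IH -(addn0 1) iotaDl -map_comp.
congr (_ :: _); first by case: s.
by apply: eq_map => j /=; case: s => [|a s]; rewrite ?nth_nil.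
Qed.

Lemma reads_false m s : reads false m s = nseq m false.
Proof. by elim: m s => //= m IH s; rewrite IH. Qed.

(** Each cell emits and stores back the bit that preceded it, so one rotation of [TD] turns [olds]
    into [belast prev olds], a shift by one place. A cell takes at most seven instructions. *)
Lemma reach_cells ph fr prev lst olds s o d t :
  reach (7 * size olds)
    (Cell ph fr false prev lst, st s o (bits olds ++ None :: d) t [::])
    (Cell ph fr false (last prev olds) (last lst (belast prev olds)),
     st (if ph && ~~ fr then drop (size olds) s else s)
        (o ++ bits (flatten [seq twin_bits ad | ad <- zip (reads (ph && ~~ fr) (size olds) s) (belast prev olds)]))
        (None :: d ++ bits (belast prev olds))
        (t ++ bits (flatten [seq twin_bits' ad | ad <- zip (reads (ph && ~~ fr) (size olds) s) (belast prev olds)]))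
        [::]).
Proof.
elim: olds prev lst s o d t => [|old olds IH] prev lst s o d t.
  by rewrite /= drop0 !cats0 if_same; apply: reach_refl.
rewrite (_ : 7 * size (old :: olds) = (7 * size olds).+1.+2.+4) /=; last lia.
qstep; rewrite andbT; case: (ph && ~~ fr) (IH) => /= {}IH; last first.
  do 5 qstep; apply: (@reach_le (7 * size olds)); first lia.
  move: (IH old prev s (rcons (rcons o (Some false)) (Some prev)) (rcons d (Some prev))
         (rcons (rcons t (Some prev)) (Some false))).
  by rewrite !reads_false -!cats1 -?catA /= -?catA /=.
do 6 qstep; apply: (@reach_le (7 * size olds)); first lia.
set a := ohead s == _.
move: (IH old prev (behead s) (rcons (rcons o (Some a)) (Some (a || prev))) (rcons d (Some prev))
         (rcons (rcons t (Some (a || prev))) (Some a))).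
have -> : drop (size olds) (behead s) = drop (size olds).+1 s.
  by case: (s); rewrite ?drop_nil.
by rewrite -!cats1 -?catA /= -?catA /=.
Qed.

Lemma reach_flush ph lst w s o d :
  reach (2 * size w + 1) (Fl ph lst, st s o d (bits w) [::])
    (if lst then if ph then Cell false true true true false else Fin
     else Cell ph false true false false, st s (o ++ bits w) d [::] [::]).
Proof.
elim: w o => [|b w IH] o.
  by rewrite cats0; qstep; apply: reach_refl.
rewrite (_ : 2 * _ + 1 = (2 * size w + 1).+2) /=; last lia.
do 2 qstep; have := IH (rcons o (Some b)).
by rewrite -cats1 -catA.
Qed.

Definition twin_rows (ads : seq (bool * bool)) :=
  flatten (map twin_bits ads) ++ flatten (map twin_bits' ads).

Lemma size_twin_bits' ads : size (flatten (map twin_bits' ads)) = 2 * size ads.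
Proof. by elim: ads => //= ad ads ->; lia. Qed.

(** The first column reads no input and is run apart; the shift inserts [fr] and drops [b]. The cost
    is 6 for the first cell, [7 * n] for the others, 2 for the end marker and [4 * n + 5] to flush
    [TT]. *)
Lemma reach_row ph fr n s o u b :
  size u = n ->
  reach (11 * n + 13)
    (Cell ph fr true fr false, st s o (bits (rcons u b) ++ [:: None]) [::] [::])
    (if last fr u then if ph then Cell false true true true false else Fin
     else Cell ph false true false false,
     st (if ph && ~~ fr then drop n s else s)
        (o ++ bits (twin_rows (zip (false :: reads (ph && ~~ fr) n s) (fr :: u))))
        (bits (fr :: u) ++ [:: None]) [::] [::]).
Proof.
move=> size_u; case def_u: (rcons u b) => [|old olds]; first by case: (u) def_u.
have [size_olds belast_u] : size olds = n /\ belast old olds = u.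
  split; first by have := congr1 size def_u; rewrite size_rcons size_u => -[].
  have := congr1 (fun w => belast fr w) def_u; rewrite belast_rcons /= => -[] //.
rewrite (_ : 11 * n + 13 = (7 * n + (4 * n + 7)).+2.+4); last lia.
qstep; rewrite !andbF; do 5 qstep.
rewrite -size_olds rcons_cat /=.
apply: reach_trans (reach_cells _ _ _ _ _ _ _ _ _) _; rewrite belast_u size_olds.
rewrite (_ : 4 * n + 7 = (4 * n + 5).+2); last lia.
do 2 qstep.
set w := flatten _; set w' := flatten _.
have size_w' : size w' = 2 * n.
  by rewrite /w' size_twin_bits' size_zip size_u readsE size_map size_iota minnn.
apply: reach_le (_ : reach (2 * size (fr :: false :: w') + 1) _ _); first by rewrite /= size_w'; lia.
have := reach_flush ph (last fr u) (fr :: false :: w') (if ph && ~~ fr then drop n s else s)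
  (rcons (rcons o (Some false)) (Some fr) ++ bits w) (Some fr :: rcons (bits u) None).
by rewrite -!cats1 -!catA /= map_cat.
Qed.

Lemma iota_cons n : iota 0 n.+1 = 0 :: map succn (iota 0 n).
Proof. by rewrite /= -(addn0 1) iotaDl. Qed.

Lemma iota_rcons n : iota 0 n.+1 = rcons (iota 0 n) n.
Proof. by rewrite -addn1 iotaD cats1. Qed.

Lemma zip_maps (T U V : Type) (f : T -> U) (g : T -> V) w :
  zip (map f w) (map g w) = [seq (f x, g x) | x <- w].
Proof. by elim: w => //= x w ->. Qed.

Definition twin_matrix (a : nat -> nat -> bool) N m :=
  flatten [seq twin_rows [seq (a i j, i == j) | j <- iota 0 N] | i <- iota 0 m].

Lemma twin_matrixS a N m : twin_matrix a N m.+1 =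
  twin_matrix a N m ++ twin_rows [seq (a m j, m == j) | j <- iota 0 N].
Proof. by rewrite /twin_matrix iota_rcons map_rcons flatten_rcons. Qed.

(** Row and column 0 belong to the added isolated vertex, so the input is indexed from 1. In the
    matching phase all entries vanish and only the diagonal flags remain. *)
Definition entry (ph : bool) n (s : seq (option bool)) i j :=
  [&& ph, i != 0, j != 0 & nth None s (i.-1 * n + j.-1) == Some true].

Lemma entry_row ph n s i :
  [seq entry ph n s i j | j <- iota 0 n.+1] =
  false :: reads (ph && (i != 0)) n (if ph then drop (i.-1 * n) s else s).
Proof.
rewrite iota_cons /= -map_comp readsE; congr (_ :: _); first by rewrite /entry !andbF.
apply: eq_map => j; rewrite /= /entry /=; case: ph => //=.
by rewrite nth_drop.
Qed.

(** Shifting unit vector [m.-1] gives unit vector [m]; for [m = 0] the inserted bit [true] starts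
    the sequence. The 1 reaches the last place exactly at [m = n], which is how the program detects
    the last row. *)
Lemma reach_matrix_row ph n m s o b : m <= n ->
  reach (11 * n + 13)
    (Cell ph (m == 0) true (m == 0) false,
     st (if ph then drop (m.-1 * n) s else s) (o ++ bits (twin_matrix (entry ph n s) n.+1 m))
        (bits (rcons [seq m == j.+1 | j <- iota 0 n] b) ++ [:: None]) [::] [::])
    (if m == n then if ph then Cell false true true true false else Fin
     else Cell ph false true false false,
     st (if ph then drop (m * n) s else s) (o ++ bits (twin_matrix (entry ph n s) n.+1 m.+1))
        (bits (rcons [seq m == j | j <- iota 0 n] (m == n)) ++ [:: None]) [::] [::]).
Proof.
move=> le_m.
have := reach_row ph (m == 0) (if ph then drop (m.-1 * n) s else s)
  (o ++ bits (twin_matrix (entry ph n s) n.+1 m)) b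
  (_ : size [seq m == j.+1 | j <- iota 0 n] = n).
rewrite size_map size_iota => /(_ erefl).
have unit_m : (m == 0) :: [seq m == j.+1 | j <- iota 0 n] = rcons [seq m == j | j <- iota 0 n] (m == n).
  by rewrite -map_rcons -iota_rcons iota_cons /= -map_comp.
have -> : last (m == 0) [seq m == j.+1 | j <- iota 0 n] = (m == n).
  by rewrite -[LHS](last_cons false) unit_m last_rcons.
rewrite -entry_row unit_m -[in zip _ _]map_rcons -iota_rcons zip_maps.
have -> : (if ph && (m != 0) then drop n (if ph then drop (m.-1 * n) s else s)
           else if ph then drop (m.-1 * n) s else s) = if ph then drop (m * n) s else s.
  by case: ph; case: (m) => //= p; rewrite drop_drop mulSn.
by rewrite -catA -map_cat twin_matrixS.
Qed.

(** The bit [b] is shifted out by the first row. It is [false] when the adjacency matrix starts and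
    [true] when the matching starts, as [TD] then still holds the last unit vector. *)
Lemma reach_matrix ph n s o b :
  reach (n.+1 * (11 * n + 13))
    (Cell ph true true true false, st s o (bits (rcons (nseq n false) b) ++ [:: None]) [::] [::])
    (if ph then Cell false true true true false else Fin,
     st (if ph then drop (n * n) s else s) (o ++ bits (twin_matrix (entry ph n s) n.+1 n.+1))
        (bits (rcons (nseq n false) true) ++ [:: None]) [::] [::]).
Proof.
have map_nseq f w : {in w, forall j : nat, f j = false} -> map f w = nseq (size w) false.
  elim: w => //= j w IH fw; rewrite fw ?mem_head // IH // => i i_w.
  by apply: fw; rewrite inE i_w orbT.
have rows m : m <= n -> exists b', reach (m * (11 * n + 13))
    (Cell ph true true true false, st s o (bits (rcons (nseq n false) b) ++ [:: None]) [::] [::])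
    (Cell ph (m == 0) true (m == 0) false,
     st (if ph then drop (m.-1 * n) s else s) (o ++ bits (twin_matrix (entry ph n s) n.+1 m))
        (bits (rcons [seq m == j.+1 | j <- iota 0 n] b') ++ [:: None]) [::] [::]).
  elim: m => [|m IH] le_m.
    exists b; rewrite drop0 if_same cats0 map_nseq // size_iota; exact: reach_refl.
  have [b' reach_m] := IH (ltnW le_m); exists (m == n).
  rewrite mulSn addnC; apply: reach_trans reach_m _.
  by have := reach_matrix_row ph s o b' (ltnW le_m); rewrite (ltn_eqF le_m).
have [b' reach_n] := rows n (leqnn n).
rewrite mulSn addnC; apply: reach_trans reach_n _.
have := reach_matrix_row ph s o b' (leqnn n); rewrite eqxx.
have -> // : [seq n == j | j <- iota 0 n] = nseq n false.
rewrite map_nseq ?size_iota // => j; rewrite mem_iota => lt_j; apply/eqP; lia.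
Qed.

Lemma reach_tail k o d :
  reach (2 * k + 4) (Fin, st (None :: nseq k (Some true)) o d [::] [::])
    (HO, st [::] (o ++ None :: nseq k.+1 (Some true)) d [::] [::]).
Proof.
rewrite (_ : 2 * k + 4 = (2 * k + 2).+2); last lia.
do 2 qstep.
have -> : o ++ None :: nseq k.+1 (Some true) = rcons o None ++ nseq k.+1 (Some true).
  by rewrite -cats1 -catA.
elim: k (rcons o None) => [|k IH] o'; first by do 2 qstep; rewrite cats1; apply: reach_refl.
rewrite (_ : 2 * k.+1 + 2 = (2 * k + 2).+2); last lia.
by do 2 qstep; have := IH (rcons o' (Some true)); rewrite -cats1 -catA.
Qed.

(** * Input and output of the whole program *)

Definition instream (x : seq bool) k : seq (option bool) := bits x ++ None :: nseq k (Some true).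

(* The part of the input that follows the unary vertex count and its delimiter. *)
Definition body x k := drop (find negb x).+1 (instream x k).

Definition prog_out n (s : seq (option bool)) : seq bool :=
  nseq (n.+1).*2 true ++ false ::
  twin_matrix (entry true n s) n.+1 n.+1 ++ twin_matrix (entry false n s) n.+1 n.+1.

(** The delimiter [a] is the first [false] of [x], or the '#' if [x] consists of [true] only. *)
Lemma instream_split x k : exists2 a, a != Some true &
  instream x k = bits (nseq (find negb x) true) ++ a :: body x k.
Proof.
rewrite /body; elim: x => [|[] x [a a_nt def_s]] /=; first by exists None; rewrite ?drop0.
  by exists a; rewrite //= -def_s.
by exists (Some false); rewrite // drop0.
Qed.

Definition prog_time n := 4 * n + 6 + 2 * (n.+1 * (11 * n + 13)).

Lemma reach_Fin x k n : n = find negb x ->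
  reach (prog_time n) (PD, st (instream x k) [::] [::] [::] [::])
    (Fin, st (drop (n * n) (body x k)) (bits (prog_out n (body x k)))
       (bits (rcons (nseq n false) true) ++ [:: None]) [::] [::]).
Proof.
move=> def_n; have [a a_nt] := instream_split x k; rewrite -def_n => ->.
rewrite /prog_time mul2n -addnn; apply: reach_trans (reach_header _ _ _ _ a_nt) _.
have -> : nseq n.+1 false = rcons (nseq n false) false by rewrite -addn1 nseqD cats1.
have := reach_trans (reach_matrix true n (body x k) (bits (rcons (nseq (n.+1).*2 true) false)) false)
  (reach_matrix false n (drop (n * n) (body x k)) _ true).
by rewrite -!map_cat -catA cat_rcons.
Qed.

Lemma drop_instream x k m :
  drop m (instream x k) =
  if m <= size x then instream (drop m x) k else nseq (k - (m - (size x).+1)) (Some true).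
Proof.
elim: x m => [|b x IH] [|m] //=.
  by rewrite drop_nseq subn1.
Qed.

Definition valid_length (x : seq bool) := size x == (find negb x).+1 + find negb x * find negb x.

Lemma prog_accepts x k (n := find negb x) : valid_length x ->
  reach (prog_time n + (2 * k + 4)) (PD, st (instream x k) [::] [::] [::] [::])
    (HO, st [::] (instream (prog_out n (body x k)) k.+1)
      (bits (rcons (nseq n false) true) ++ [:: None]) [::] [::]).
Proof.
move=> /eqP val_x; apply: reach_trans (reach_Fin _ (erefl n)) _.
rewrite /body drop_drop (_ : n * n + n.+1 = size x); last by rewrite val_x addnC.
rewrite drop_instream leqnn drop_size.
exact: reach_tail.
Qed.

(** If [x] is too long, [Fin] meets a leftover bit; if too short, the '#' has been consumed as a bit
    and only parameter symbols or nothing remain. *)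
Lemma prog_rejects x k (n := find negb x) : ~~ valid_length x ->
  exists i o d, reach (prog_time n + 2) (PD, st (instream x k) [::] [::] [::] [::])
    (HR, st i o d [::] [:: None]).
Proof.
move=> inval_x.
suff head_ne : ohead (drop (n * n) (body x k)) != Some None.
  do 3 eexists; apply: reach_trans (reach_Fin _ (erefl n)) _.
  by qstep; rewrite (negbTE head_ne); qstep; apply: reach_refl.
rewrite /body drop_drop drop_instream addnC.
case: ifP => [le_m|_]; last by case: (k - _).
have : size (drop (n.+1 + n * n) x) != 0 by rewrite size_drop subn_eq0 -ltnNge ltn_neqAle le_m eq_sym andbT.
by case: (drop _ x).
Qed.

(** * Encodings *)

(** Working with relations on naturals avoids casts when the number of vertices changes. *)
Definition nat_rel n (a : nat -> nat -> bool) : rel 'I_n := fun i j => a i j.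

Lemma enc_relE n a : enc_rel (nat_rel (n := n) a) =
  flatten [seq [seq a i j | j <- iota 0 n] | i <- iota 0 n].
Proof.
rewrite /enc_rel -val_enum_ord -map_comp; congr flatten.
by apply: eq_map => i; rewrite /= -map_comp.
Qed.

Lemma eq_enc_rel n (e1 e2 : rel 'I_n) : e1 =2 e2 -> enc_rel e1 = enc_rel e2.
Proof.
by move=> e12; congr flatten; apply: eq_map => i; apply: eq_map => j; apply: e12.
Qed.

Lemma size_enc_rel n (e : rel 'I_n) : size (enc_rel e) = n * n.
Proof. by rewrite size_allpairs size_enum_ord. Qed.

Lemma enc_rel_inj n (e1 e2 : rel 'I_n) : enc_rel e1 = enc_rel e2 -> e1 =2 e2.
Proof.
move=> e12 i j.
have rows w : flatten [seq [seq e1 i j | j <- enum 'I_n] | i <- w] =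
    flatten [seq [seq e2 i j | j <- enum 'I_n] | i <- w] ->
    {in w, forall i, [seq e1 i j | j <- enum 'I_n] = [seq e2 i j | j <- enum 'I_n]}.
  elim: w => //= i0 w IH /eqP; rewrite eqseq_cat ?size_map // => /andP[/eqP row0 /eqP /IH rows].
  by move=> i1; rewrite inE => /predU1P[-> //|]; apply: rows.
have /eq_in_map := rows _ e12 i (mem_enum _ i).
by apply; rewrite mem_enum.
Qed.

Lemma find_enc n w : find negb (nseq n true ++ false :: w) = n.
Proof. by elim: n => //= n ->. Qed.

(** The unary header is self-delimiting: [find negb] recovers its length. *)
Lemma enc_prefix_inj n1 n2 (w1 w2 : seq bool) :
  nseq n1 true ++ false :: w1 = nseq n2 true ++ false :: w2 -> n1 = n2 /\ w1 = w2.
Proof.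
move=> eq12; have eqn : n1 = n2 by rewrite -(find_enc n1 w1) eq12 find_enc.
by move/eqP: eq12; rewrite eqn eqseq_cat // => /andP[_ /eqP[]].
Qed.

Definition adj (x : seq bool) (i j : nat) : bool :=
  let n := find negb x in nth false x (n.+1 + (i * n + j)).

(** Every string of the right length encodes some relation, possibly with loops or asymmetric;
    simplicity is handled by [simple_twin]. *)
Lemma valid_enc_graph x (n := find negb x) : valid_length x ->
  x = enc_graph (nat_rel (n := n) (adj x)).
Proof.
move=> /eqP size_x.
have rows m : m <= n -> flatten [seq [seq adj x i j | j <- iota 0 n] | i <- iota 0 m] =
    take (m * n) (drop n.+1 x).
  elim: m => [|m IH] le_m; first by rewrite take0.
  rewrite iota_rcons map_rcons flatten_rcons IH 1?ltnW // mulSn addnC takeD; congr (_ ++ _).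
  rewrite drop_drop -(map_nth_iota false); last by rewrite size_x -/n; nia.
  rewrite -[m * n + n.+1]addn0 iotaDl -map_comp; apply: eq_map => j.
  by rewrite /= /adj -/n; congr nth; lia.
have n_lt : n < size x by rewrite size_x -/n; lia.
rewrite /enc_graph enc_relE rows // take_oversize; last by rewrite size_drop size_x -/n; lia.
(* As [n] is the position of the first [false], the prefix is all [true] and the next bit is the
   delimiter. *)
rewrite -[LHS](cat_take_drop n) (drop_nth true) //; congr (_ ++ _ :: _).
  apply: (@eq_from_nth _ true); first by rewrite size_takel ?size_nseq // ltnW.
  move=> i; rewrite (size_takel (ltnW n_lt)) => lt_i; rewrite nth_take // nth_nseq lt_i.
  by apply: negbFE; apply: before_find lt_i.
apply: negbTE; apply: (@nth_find _ true negb); rewrite has_find; exact: n_lt.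
Qed.

Lemma enc_graph_valid n (e : rel 'I_n) : valid_length (enc_graph e).
Proof.
rewrite /valid_length /enc_graph find_enc size_cat size_nseq /= size_enc_rel.
by apply/eqP; lia.
Qed.

(** The disjoint union with [K_1]: vertex 0 is isolated and the old vertices move up by one. *)
Definition add_vertex (a : nat -> nat -> bool) i j := [&& i != 0, j != 0 & a i.-1 j.-1].

(* Vertex [i] is replaced by the adjacent twins [2 i] and [2 i + 1]. *)
Definition twin (a : nat -> nat -> bool) p q :=
  a p./2 q./2 || ((p./2 == q./2) && (p != q)).

Lemma map_iota_double (T : Type) (f : nat -> T) m :
  map f (iota 0 m.*2) = flatten [seq [:: f i.*2; f i.*2.+1] | i <- iota 0 m].
Proof.
elim: m => // m IH; rewrite doubleS 2!iota_rcons !map_rcons iota_rcons map_rcons flatten_rcons -IH.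
by rewrite -!cats1 -catA.
Qed.

Lemma flatten_iota_double (T : Type) (f : nat -> seq T) m :
  flatten (map f (iota 0 m.*2)) = flatten [seq f i.*2 ++ f i.*2.+1 | i <- iota 0 m].
Proof.
elim: m => // m IH; rewrite doubleS 2!iota_rcons !map_rcons iota_rcons map_rcons !flatten_rcons -IH.
by rewrite catA.
Qed.

Lemma enc_twin a N : enc_rel (nat_rel (n := N.*2) (twin a)) = twin_matrix a N N.
Proof.
rewrite enc_relE flatten_iota_double; congr flatten; apply: eq_map => i.
have half0 m : m.*2./2 = m by lia.
have half1 m : m.*2.+1./2 = m by lia.
rewrite /twin_rows !map_iota_double -!map_comp; congr (flatten _ ++ flatten _);
  apply: eq_map => j; rewrite /twin !half0 !half1 /twin_bits /twin_bits' [_ _ j]/=;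
  congr [:: _; _]; case: (a i j) => //=; lia.
Qed.

Lemma eq_twin_matrix a b N : (forall i j, i < N -> j < N -> a i j = b i j) ->
  twin_matrix a N N = twin_matrix b N N.
Proof.
move=> ab; congr flatten; apply/eq_in_map => i; rewrite mem_iota => /= lt_i.
by congr twin_rows; apply/eq_in_map => j; rewrite mem_iota => /= lt_j; rewrite ab.
Qed.

Lemma prog_out_enc x k (n := find negb x) : valid_length x ->
  prog_out n (body x k) =
  enc_graph (nat_rel (n := n.+1.*2) (twin (add_vertex (adj x)))) ++
  enc_rel (nat_rel (n := n.+1.*2) (twin (fun _ _ => false))).
Proof.
move=> /eqP size_x; rewrite /prog_out /enc_graph -catA cat_cons !enc_twin; congr (_ ++ _ :: _ ++ _).
apply: eq_twin_matrix => -[|i] [|j] // lt_i lt_j.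
rewrite /entry /add_vertex /= /adj -/n /body nth_drop /instream nth_cat size_map.
have lt_x : n.+1 + (i * n + j) < size x by rewrite size_x -/n; nia.
by rewrite lt_x (nth_map false) //; case: nth.
Qed.

(** * Twin graphs *)

Lemma subset_of_card (T : finType) (S : {set T}) k : k <= #|S| ->
  exists2 B : {set T}, B \subset S & #|B| = k.
Proof.
move=> le_k; exists [set:: take k (enum S)].
  by apply/subsetP => x; rewrite inE => /mem_take; rewrite mem_enum.
have /card_uniqP card_B : uniq (take k (enum S)) by rewrite take_uniq ?enum_uniq.
rewrite -[RHS](size_takel (s := enum S)); last by rewrite -cardE.
by rewrite -card_B; apply: eq_card => x; rewrite inE.
Qed.

(** Edges of a matching are disjoint and, without loops, have two endpoints each. This bounds the
    matching of any instance decoded from the output. *)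
Lemma matching_card n (e : rel 'I_n) M : simple_graph e -> is_matching e M -> 2 * #|M| <= n.
Proof.
move=> [irr _] [/subsetP M_edges M_disj].
have M_triv : trivIset M by apply/trivIsetP.
rewrite -[n in _ <= n]card_ord; apply: leq_trans (max_card (cover M)).
rewrite -(eqP M_triv) (eq_bigr (fun=> 2)) ?sum_nat_const 1?mulnC // => f /M_edges.
rewrite inE => /existsP[i /existsP[j /andP[eij /eqP ->]]].
by rewrite cards2; case: eqP => // eq_ij; rewrite eq_ij (negbTE (irr j)) in eij.
Qed.

Lemma twin_even b i j : twin b i.*2 j.*2 = b i j.
Proof. by rewrite /twin !doubleK; case: (i =P j) => [->|]; rewrite ?eqxx ?orbF. Qed.

Section TwinGraph.
Variables (n : nat) (a : nat -> nat -> bool).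
Let N := n.+1.
Let V := 'I_N.*2.
Let G : rel 'I_n := nat_rel a.
Let G' : rel V := nat_rel (twin (add_vertex a)).

Lemma half_lt (p : V) : p./2 < N.
Proof. by have := ltn_ord p; lia. Qed.
Definition base (p : V) : 'I_N := Ordinal (half_lt p).

Lemma even_lt (i : 'I_N) : i.*2 < N.*2.
Proof. by have := ltn_ord i; lia. Qed.
Definition even_twin (i : 'I_N) : V := Ordinal (even_lt i).

Lemma odd_lt (i : 'I_N) : i.*2.+1 < N.*2.
Proof. by have := ltn_ord i; lia. Qed.
Definition odd_twin (i : 'I_N) : V := Ordinal (odd_lt i).

Definition twin_pair (i : 'I_N) : {set V} := [set p | base p == i].
Definition pairs : {set {set V}} := [set twin_pair i | i : 'I_N].

Lemma base_even i : base (even_twin i) = i.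
Proof. by apply: val_inj => /=; lia. Qed.

Lemma pairE i : twin_pair i = [set even_twin i; odd_twin i].
Proof. by apply/setP => p; rewrite !inE -!val_eqE /=; lia. Qed.

Lemma pair_inj : injective twin_pair.
Proof.
move=> i j /setP /(_ (even_twin i)); rewrite !inE base_even eqxx => /esym /eqP //.
Qed.

Lemma card_pairs : #|pairs| = N.
Proof. by rewrite card_imset ?card_ord //; exact: pair_inj. Qed.

(** This makes the matrix of [pairs] the twin matrix of the edgeless graph, which the second pass
    prints. *)
Lemma mem_pairs p q : ([set p; q] \in pairs) = twin (fun _ _ => false) p q.
Proof.
rewrite /twin /=; apply/imsetP/andP => [[i _ def_i]|[/eqP pq ne_pq]].
  have /[!inE] /eqP pi : p \in twin_pair i by rewrite -def_i !inE eqxx.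
  have /[!inE] /eqP qi : q \in twin_pair i by rewrite -def_i !inE eqxx orbT.
  split; first by move: pi qi => /(congr1 val) /= -> /(congr1 val) /= ->.
  apply/eqP => /val_inj eq_pq; move: def_i; rewrite eq_pq setUid pairE => /(congr1 (fun S : {set V} => #|S|)).
  by rewrite cards1 cards2 -val_eqE /=; lia.
exists (base p) => //; apply/setP => r; rewrite !inE -!val_eqE /=.
by move: ne_pq pq; lia.
Qed.

(** The even twins of the old vertices carry a copy of [G], so defects of the input matrix survive;
    conversely, adding twins creates no loop and keeps symmetry. *)
Lemma simple_twin : simple_graph G' <-> simple_graph G.
Proof.
split=> -[irr sym]; split=> [i|i j].
- by have := irr (even_twin (lift ord0 i)); rewrite /G' /nat_rel twin_even.
- by have := sym (even_twin (lift ord0 i)) (even_twin (lift ord0 j)); rewrite /G' /nat_rel !twin_even.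
- rewrite /G' /nat_rel /twin !eqxx andbF orbF /add_vertex.
  have := half_lt i; case: (i./2) => [|m] //= lt_m.
  exact: (irr (Ordinal (lt_m : m < n))).
- rewrite /G' /nat_rel /twin [j./2 == _]eq_sym [val j == _]eq_sym /add_vertex.
  have := half_lt i; have := half_lt j; case: (i./2) => [|m]; case: (j./2) => [|m'] //= lt_m' lt_m.
  by congr (_ || _); apply: (sym (Ordinal (lt_m : m < n)) (Ordinal (lt_m' : m' < n))).
Qed.

Lemma pairs_maximal_matching : is_maximal_matching G' pairs.
Proof.
split.
  split.
    apply/subsetP => f /imsetP[i _ ->]; rewrite inE; apply/existsP; exists (even_twin i).
    apply/existsP; exists (odd_twin i); rewrite pairE eqxx andbT /G' /nat_rel /twin /=.
    by apply/orP; right; lia.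
  move=> f g /imsetP[i _ ->] /imsetP[j _ ->] ne_ij; apply/pred0P => p /=; rewrite !inE.
  by apply/negP => /andP[/eqP pi /eqP pj]; rewrite -pi -pj eqxx in ne_ij.
move=> f; rewrite inE => /existsP[p /existsP[q /andP[_ /eqP ->]]] f_notin [_ disj].
(* The pairs cover all vertices, so a further edge at [p] would share [p] with its pair. *)
have pair_in : twin_pair (base p) \in pairs by apply: imset_f.
have /disj : [set p; q] \in [set p; q] |: pairs by apply: setU11.
move=> /(_ (twin_pair (base p)) (setU1r _ pair_in)).
have -> : [set p; q] != twin_pair (base p) by apply: contraNneq f_notin => ->.
by move=> /(_ isT) /pred0P /(_ p) /=; rewrite !inE !eqxx.
Qed.

(** The cover is the complement of one twin for each vertex of [S] and for the added vertex. *)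
Lemma cover_of_independent (S : {set 'I_n}) : is_independent G S ->
  exists C : {set V}, is_vertex_cover G' C /\ #|C| + #|S|.+1 <= 2 * #|pairs|.
Proof.
move=> indS; pose T := even_twin @: (ord0 |: lift ord0 @: S).
have card_T : #|T| = #|S|.+1.
  rewrite card_imset; last by move=> i j /(congr1 base); rewrite !base_even.
  rewrite cardsU1 card_imset; last exact: lift_inj.
  by rewrite (_ : ord0 \in _ = false) //; apply/imsetP => -[i _ /eqP].
exists (~: T); split; last first.
  by have := cardsC T; rewrite card_T card_pairs card_ord addnC => ->; rewrite mul2n.
move=> p q; rewrite !inE -negb_and; apply: contraTN => /andP[/imsetP[i Si ->] /imsetP[j Sj ->]].
rewrite /G' /nat_rel twin_even.
move: Si Sj; rewrite !inE => /predU1P[-> //|/imsetP[i' Si' ->]].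
move=> /predU1P[->|/imsetP[j' Sj' ->]]; first by rewrite /add_vertex andbF.
by apply: indS.
Qed.

Lemma independent_of_cover (e : rel V) C M k : e =2 G' -> simple_graph e -> is_vertex_cover e C ->
  is_matching e M -> #|C| + k.+1 <= 2 * #|M| ->
  exists S : {set 'I_n}, is_independent G S /\ #|S| = k.
Proof.
move=> eG simple_e coverC matchM le_M; pose T := ~: C.
have indT p q : p \in T -> q \in T -> ~~ G' p q.
  by rewrite !inE -eG => pC qC; apply/negP => /coverC; rewrite (negbTE pC) (negbTE qC).
(* Twins are adjacent, so the independent set [T] has at most one from each pair. *)
have base_inj : {in T &, injective base}.
  move=> p q Tp Tq /(congr1 val) /= pq; apply: val_inj; apply/eqP.
  by have := indT p q Tp Tq; rewrite /G' /nat_rel /twin pq eqxx negb_or negbK => /andP[].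
(* Both [#|C| + k.+1 <= 2 * #|M|] and [2 * #|M| <= #|V|] hold, and [#|V| = #|C| + #|T|]. *)
have card_T : k.+1 <= #|base @: T|.
  rewrite card_in_imset //; have := cardsC C; have := matching_card simple_e matchM.
  rewrite card_ord -/T => le_N card_C; rewrite -(leq_add2l #|C|) card_C.
  exact: leq_trans le_N.
pose S := [set i | lift ord0 i \in base @: T].
have card_S : k <= #|S|.
  rewrite -(card_imset S (@lift_inj _ (ord0 : 'I_N))).
  (* Leaving out the added vertex costs at most one element, so at least [k] remain. *)
  have -> : lift ord0 @: S = (base @: T) :\ ord0.
    apply/setP => i; rewrite !inE; apply/imsetP/andP => [[j]|[i_ne Ti]].
      by rewrite inE => Tj ->.
    by case: (unliftP ord0 i) i_ne Ti => [j ->|->] // _ Tj; exists j; rewrite ?inE.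
  by move: card_T; rewrite (cardsD1 ord0); case: (ord0 \in _) => // /ltnW.
have [B /subsetP BS card_B] := subset_of_card card_S; exists B; split=> // i j.
move=> /BS; rewrite inE => /imsetP[p Tp /(congr1 val) /= pi].
move=> /BS; rewrite inE => /imsetP[q Tq /(congr1 val) /= qj].
have := indT p q Tp Tq; rewrite /G' /nat_rel /twin -pi -qj /add_vertex /bump !add1n /=.
by rewrite negb_or => /andP[].
Qed.

End TwinGraph.

(** * The reduction *)

(** A string of the wrong length is sent to a no-instance, as [VCU2] demands a positive
    parameter. *)
Definition reduction (x : seq bool) (k : nat) : seq bool * nat :=
  if valid_length x then (prog_out (find negb x) (body x k), k.+1) else ([::], 0).

Lemma simple_graph_eq n (e1 e2 : rel 'I_n) : e1 =2 e2 -> simple_graph e1 -> simple_graph e2.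
Proof. by move=> e12 [irr sym]; split=> [i|i j]; rewrite -!e12. Qed.

Lemma reduction_correct x k :
  IndependentSet x k <-> VCU2 (reduction x k).1 (reduction x k).2.
Proof.
rewrite /reduction; case: ifPn => [val_x|inval_x] /=; last first.
  split=> [[n [e [def_x _]]]|[n [e [M [_ [_ [_ []]]]]]] //].
  by rewrite def_x enc_graph_valid in inval_x.
have def_x := valid_enc_graph val_x; rewrite (prog_out_enc k val_x).
set n := find negb x in def_x *; split.
  case=> n' [e [def_x' [simple_e [S [indS card_S]]]]].
  move: def_x'; rewrite {1}def_x => /enc_prefix_inj [eq_n].
  case: n' / eq_n e simple_e S indS card_S => e simple_e S indS card_S /enc_rel_inj eq_e.
  have simple_x : simple_graph (nat_rel (n := n) (adj x)) by apply: simple_graph_eq simple_e => i j.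
  exists n.+1.*2, (nat_rel (twin (add_vertex (adj x)))), (pairs n); split.
    by rewrite /enc_graph_matching; congr (_ ++ _); apply: eq_enc_rel => p q; rewrite mem_pairs.
  split; first by apply/simple_twin.
  split; first exact: pairs_maximal_matching.
  split=> //; rewrite -card_S; apply: cover_of_independent => i j Si Sj.
  by rewrite eq_e; apply: indS.
case=> n' [e [M [def_x' [simple_e [[matchM _] [_ [C [coverC le_M]]]]]]]].
(* The header fixes the number of vertices, hence the length of the first matrix, which can then be
   split from the second. *)
move: def_x'; rewrite /enc_graph_matching /enc_graph -!catA => /(@enc_prefix_inj _ _ (_ ++ _) (_ ++ _))[eq_n].
case: n' / eq_n e M simple_e matchM C coverC le_M => e M simple_e matchM C coverC le_M.
move/eqP; rewrite eqseq_cat ?size_enc_rel // => /andP[/eqP /enc_rel_inj eq_e _].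
have eG : e =2 nat_rel (twin (add_vertex (adj x))) by move=> p q; rewrite eq_e.
have [S [indS card_S]] := independent_of_cover eG simple_e coverC matchM le_M.
exists n, (nat_rel (adj x)); split=> //; split; last by exists S.
by apply/simple_twin; apply: simple_graph_eq simple_e.
Qed.

(** * Computability of the parameter bound and running time *)

Definition succ_delta (q : 'I_4) (a : 'I_4) : option ('I_4 * 'I_4 * bool) :=
  match val q with
  | 0 => Some (@Ordinal 4 1 isT, a, false)
  | 1 => Some (@Ordinal 4 2 isT, @Ordinal 4 2 isT, false)
  | 2 => Some (@Ordinal 4 3 isT, ord0, true)
  | _ => None
  end.

Lemma computable_succn : computable succn.
Proof.
exists (@mkTM 3 0 succ_delta) => n; exists 3; rewrite /computes_within.
have two : nat_of_ord (inord 2 : 'I_4) = 2 by rewrite inordK.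
case: n => [|n]; first by [].
split=> //=; rewrite two !map_nseq two; congr [:: _, _ & _].
by elim: n => //= n ->.
Qed.

Lemma enc_inst_code x k : enc_inst x k = map code (instream x k).
Proof.
rewrite /enc_inst /instream map_cat -map_comp /= map_nseq.
by congr (_ ++ _); apply: eq_map => -[].
Qed.

Lemma size_instream x k : size (instream x k) = (size x + k).+1.
Proof. by rewrite size_cat size_map /= size_nseq addnS. Qed.

(** The program takes quadratically many steps and its simulation squares this. The constant
    [22 * 47] is below [2 ^ 11], hence absorbed by [s ^ 11] since [s] is at least 2; with [s ^ 4]
    this gives the exponent 15. *)
Lemma time_bound m k s : m + k + 2 <= s ->
  forall n w, n <= prog_time m + (2 * k + 4) -> w < s ->
  n.+1 * ((w + n).*2 + 5) <= s ^ 15.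
Proof.
move=> le_s n w le_n le_w.
have le_n' : n.+1 <= 22 * s ^ 2 by rewrite /prog_time in le_n; rewrite expnS expn1; nia.
have le_w' : (w + n).*2 + 5 <= 47 * s ^ 2 by rewrite expnS expn1 in le_n' *; nia.
apply: leq_trans (leq_mul le_n' le_w') _.
rewrite -[15]/(11 + (2 + 2)) !expnD mulnACA leq_mul2r; apply/orP; right.
by apply: (@leq_trans (2 ^ 11)) => //; rewrite leq_exp2r; lia.
Qed.

Theorem theorem5 : W1_hard VCU2.
Proof.
have [M M_computes] := queue_machine_TM prog PD TI.
exists reduction, M, succn, succn, 15; do 2 (split; first exact: computable_succn).
split; first exact: reduction_correct.
split=> [x k|x k]; first by rewrite /reduction; case: ifP.
rewrite !enc_inst_code.
have init_st : [ffun u => if u == TI then instream x k else [::]] = st (instream x k) [::] [::] [::] [::].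
  by apply/ffunP; case; rewrite !ffunE.
have le_m := find_size negb x.
have bound n : n <= prog_time (find negb x) + (2 * k + 4) ->
    n.+1 * ((size (instream x k) + n).*2 + 5) <= k.+1 * (size x + k).+2 ^ 15.
  move=> le_n; apply: (@leq_trans ((size x + k).+2 ^ 15)); last by rewrite leq_pmull.
  by apply: (time_bound _ le_n); rewrite ?size_instream //; lia.
rewrite /reduction; case: ifPn => [val_x|inval_x].
  have [n le_n run_n] := prog_accepts k val_x.
  rewrite -init_st in run_n; have := M_computes _ _ _ TO _ _ run_n erefl _ (bound n le_n).
  by rewrite size_instream ffunE; apply.
(* Here [TR] holds a single '#', the encoding of [([::], 0)]. *)
have [i [o [d [n le_n run_n]]]] := prog_rejects k inval_x.
rewrite -init_st in run_n; have := M_computes _ _ _ TR _ _ run_n erefl _ (bound n (leq_trans le_n _)).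
by rewrite size_instream ffunE; apply; lia.
Qed.
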